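(* Let $m\in\mathbb{N}$ and let $p_1,\dots,p_m$ be integers with $p_i>1$ for all $i$ and $\sum_{j=1}^m \frac{1}{p_j} < m-1$. Let $\Gamma_{p_1,\ldots,p_m} = \langle x_1,\ldots,x_m \mid x_1^{p_1}=\cdots=x_m^{p_m}\rangle$ and let $\Phi_{p_1,\ldots,p_m}:\Gamma_{p_1,\ldots,p_m}\to C_{p_1}*\cdots*C_{p_m}$ be the surjective homomorphism sending $x_j$ to a generator of $C_{p_j}$. Then $$\frac{\left|\left\{\rho\in\mathrm{Hom}(\Gamma_{p_1,\ldots,p_m},S_n):\ \rho\text{ factors through }\Phi_{p_1,\ldots,p_m}\right\}\right|}{\left|\mathrm{Hom}(\Gamma_{p_1,\ldots,p_m},S_n)\right|}\longrightarrow 1\quad\text{as } n\to\infty.$$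
   Context: $C_p$ denotes the cyclic group of order $p$, $*$ the free product, and $S_n$ the symmetric group on $n$ elements. A homomorphism $\rho$ factors through $\Phi_{p_1,\ldots,p_m}$ if $\rho=\bar\rho\circ\Phi_{p_1,\ldots,p_m}$ for some homomorphism $\bar\rho: C_{p_1}*\cdots*C_{p_m}\to S_n$. *)

(* Defs.v *)
From HB Require Import structures.
From mathcomp Require Import all_boot all_order all_algebra all_fingroup.
From mathcomp Require Import all_solvable.
From mathcomp Require Import finmap boolp classical_sets functions cardinality.
From mathcomp Require Import reals topology normedtype sequences.
From mathcomp Require Import generic_quotient.

Set Implicit Arguments.
Unset Strict Implicit.
Unset Printing Implicit Defensive.

Local Open Scope group_scope.
Local Open Scope quotient_scope.

(* Words in the letters x and x^-1: (x, false) stands for x and (x, true) for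
   x^-1. *)
Definition word (X : Type) := seq (X * bool).

Definition inv_letter X (a : X * bool) : X * bool := (a.1, ~~ a.2).

Definition inv_word X (u : word X) : word X := rev (map (@inv_letter X) u).

Inductive word_cong X (rel : word X -> word X -> Prop) :
    word X -> word X -> Prop :=
| WordRel u v : rel u v -> word_cong rel u v
| WordCancel a : word_cong rel [:: a; inv_letter a] [::]
| WordRefl u : word_cong rel u u
| WordSym u v : word_cong rel u v -> word_cong rel v u
| WordTrans u v w : word_cong rel u v -> word_cong rel v w -> word_cong rel u w
| WordCat u u' v v' :
    word_cong rel u u' -> word_cong rel v v' ->
    word_cong rel (u ++ v) (u' ++ v').

Section Presentation.
Variables (X : choiceType) (rel : word X -> word X -> Prop).

Let cong (u v : word X) := `[< word_cong rel u v >].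

Fact word_cong_refl : reflexive cong.
Proof. by move=> u; apply/asboolP/WordRefl. Qed.

Fact word_cong_sym : symmetric cong.
Proof. by move=> u v; apply/asboolP/asboolP => /WordSym. Qed.

Fact word_cong_trans : transitive cong.
Proof.
by move=> v u w /asboolP uv /asboolP vw; apply/asboolP/(WordTrans uv).
Qed.

Definition word_equiv : equiv_rel (word X) :=
  EquivRel cong word_cong_refl word_cong_sym word_cong_trans.

(* The group < X | u = v for all u, v such that rel u v >. *)
Definition presented : Type := {eq_quot word_equiv}.

HB.instance Definition _ := Choice.on presented.

Definition pres_class (u : word X) : presented := \pi_presented u.

Definition pres_gen (x : X) : presented := pres_class [:: (x, false)].

Lemma pres_classP u v : word_cong rel u v <-> pres_class u = pres_class v.
Proof. by split=> [|/eqmodP/asboolP//] uv; apply/eqmodP/asboolP. Qed.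

Lemma pres_class_repr (g : presented) : pres_class (repr g) = g.
Proof. exact: reprK. Qed.

Definition pres_one : presented := pres_class [::].
Definition pres_mul (g h : presented) : presented :=
  pres_class (repr g ++ repr h).
Definition pres_inv (g : presented) : presented :=
  pres_class (inv_word (repr g)).

Let repr_class u : word_cong rel (repr (pres_class u)) u.
Proof. by apply/pres_classP; rewrite pres_class_repr. Qed.

Lemma pres_mulE u v :
  pres_mul (pres_class u) (pres_class v) = pres_class (u ++ v).
Proof. by apply/pres_classP/WordCat; apply: repr_class. Qed.

Let inv_letterK : involutive (@inv_letter X).
Proof. by case=> x b; rewrite /inv_letter /= negbK. Qed.

Let inv_wordK : involutive (@inv_word X).
Proof.
by move=> u; rewrite /inv_word map_rev revK -map_comp (eq_map inv_letterK) map_id.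
Qed.

Let word_mulV u : word_cong rel (u ++ inv_word u) [::].
Proof.
elim: u => [|a u IHu]; first exact: WordRefl.
rewrite /inv_word /= rev_cons -cats1 catA -cat1s.
apply: WordTrans (WordCancel rel a).
apply: (@WordCat _ _ [:: a] [:: a] _ [:: inv_letter a]); first exact: WordRefl.
rewrite -[X in word_cong _ _ X]cat0s; apply: WordCat; last exact: WordRefl.
exact: IHu.
Qed.

Let pres_mulA : associative pres_mul.
Proof.
move=> f g h; rewrite -[f]pres_class_repr -[g]pres_class_repr.
by rewrite -[h]pres_class_repr !pres_mulE catA.
Qed.

Let pres_mul1 : left_id pres_one pres_mul.
Proof. by move=> g; rewrite -[g]pres_class_repr pres_mulE. Qed.

Let pres_mulr1 : right_id pres_one pres_mul.
Proof. by move=> g; rewrite -[g]pres_class_repr pres_mulE cats0. Qed.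

Let pres_mulV : left_inverse pres_one pres_inv pres_mul.
Proof.
move=> g; rewrite -[X in pres_mul _ X]pres_class_repr pres_mulE.
by apply/pres_classP; rewrite -[X in _ ++ X]inv_wordK; apply: word_mulV.
Qed.

Let pres_mulrV : right_inverse pres_one pres_inv pres_mul.
Proof.
move=> g; rewrite -[X in pres_mul X _]pres_class_repr pres_mulE.
by apply/pres_classP/word_mulV.
Qed.

HB.instance Definition _ :=
  isGroup.Build presented pres_mulA pres_mul1 pres_mulr1 pres_mulV pres_mulrV.

Lemma pres_class_cat u v : pres_class (u ++ v) = pres_class u * pres_class v.
Proof. by rewrite -pres_mulE. Qed.

Lemma pres_class_nil : pres_class [::] = 1.
Proof. by []. Qed.

Lemma pres_class_letter a :
  pres_class [:: a] = if a.2 then (pres_gen a.1)^-1 else pres_gen a.1.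
Proof.
case: a => x [] //=; apply: (mulgI (pres_gen x)).
rewrite mulgV -pres_class_cat; apply/pres_classP.
exact: (WordCancel rel (x, false)).
Qed.

Lemma pres_ind (P : presented -> Prop) :
  P 1 -> (forall x g, P g -> P (pres_gen x * g)) ->
  (forall x g, P g -> P ((pres_gen x)^-1 * g)) -> forall g, P g.
Proof.
move=> P1 Pg PV g; rewrite -[g]pres_class_repr.
elim: (repr g) => [|a u IHu]; first by rewrite pres_class_nil.
rewrite -cat1s pres_class_cat pres_class_letter.
by case: a.2; [apply: PV | apply: Pg].
Qed.

Lemma pres_class_nseq k x :
  pres_class (nseq k (x, false)) = (pres_gen x) ^+ k.
Proof.
elim: k => [|k IHk]; first by rewrite expg0 pres_class_nil.
by rewrite expgS -IHk -pres_class_cat.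
Qed.

Section UniversalProperty.
Variables (H : groupType) (f : X -> H).

Definition word_eval (u : word X) : H :=
  \prod_(a <- u) (if a.2 then (f a.1)^-1 else f a.1).

Lemma pres_lift :
    (forall u v, rel u v -> word_eval u = word_eval v) ->
  exists g : {multiplicative presented -> H}, forall x, g (pres_gen x) = f x.
Proof.
move=> f_rel.
have f_cong u v : word_cong rel u v -> word_eval u = word_eval v.
  elim=> {u v} [//|a|//|//|u v w _ -> _ -> //|u u' v v' _ Eu _ Ev].
  - rewrite /word_eval !big_cons big_nil mulg1 /=.
    by case: a => x [] /=; rewrite ?mulgV ?mulVg.
  - by rewrite /word_eval !big_cat /= -/(word_eval u) -/(word_eval v) Eu Ev.
pose g (c : presented) := word_eval (repr c).
have gE u : g (pres_class u) = word_eval u by apply/f_cong/repr_class.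
have gM : {morph g : c d / c * d}.
  move=> c d; rewrite -[c]pres_class_repr -[d]pres_class_repr -pres_class_cat.
  by rewrite !gE /word_eval big_cat.
pose gm := isMultiplicative.Build _ _ g gM.
exists (HB.pack_for {multiplicative presented -> H} g gm) => x /=.
by rewrite gE /word_eval big_seq1.
Qed.

End UniversalProperty.

Lemma pres_morph_ext (H : groupType) (f g : presented -> H) :
    {morph f : c d / c * d} -> {morph g : c d / c * d} ->
  (forall x, f (pres_gen x) = g (pres_gen x)) -> f = g.
Proof.
move=> fM gM fg.
have f1 : f 1 = 1 by apply: (mulgI (f 1)); rewrite -fM !mulg1.
have g1 : g 1 = 1 by apply: (mulgI (g 1)); rewrite -gM !mulg1.
have fV c : f c^-1 = (f c)^-1 by apply: (mulgI (f c)); rewrite -fM !mulgV.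
have gV c : g c^-1 = (g c)^-1 by apply: (mulgI (g c)); rewrite -gM !mulgV.
apply/funext; apply: pres_ind => [|x c IHc|x c IHc]; first by rewrite f1 g1.
- by rewrite fM gM IHc fg.
- by rewrite fM gM fV gV IHc fg.
Qed.

End Presentation.

(* The free product of the G i: generated by the disjoint union of the G i,
   subject to the multiplication table of each G i. *)
Section FreeProduct.
Variables (I : choiceType) (G : I -> groupType).

Definition free_prod_rel (u v : word {i : I & G i}) : Prop :=
  exists i (a b : G i),
    u = [:: (Tagged G a, false); (Tagged G b, false)] /\
    v = [:: (Tagged G (a * b), false)].

Definition free_prod := presented free_prod_rel.

HB.instance Definition _ := Group.on free_prod.

Definition free_prod_inj (i : I) (a : G i) : free_prod :=
  pres_gen free_prod_rel (Tagged G a).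

Lemma free_prod_injM i : {morph @free_prod_inj i : a b / a * b}.
Proof.
move=> a b; rewrite /free_prod_inj /pres_gen -[RHS]pres_class_cat.
by apply/esym/pres_classP/WordRel; exists i, a, b.
Qed.

HB.instance Definition _ i :=
  isMultiplicative.Build _ _ (@free_prod_inj i) (@free_prod_injM i).

Lemma free_prod_inj1 i : @free_prod_inj i 1 = 1.
Proof.
by apply: (mulgI (@free_prod_inj i 1)); rewrite -free_prod_injM !mulg1.
Qed.

Lemma free_prod_injX i (a : G i) k :
  free_prod_inj (a ^+ k) = (free_prod_inj a) ^+ k.
Proof.
by elim: k => [|k IHk]; rewrite ?free_prod_inj1 // !expgS free_prod_injM IHk.
Qed.

Lemma free_prod_lift (H : groupType) (f : forall i, {multiplicative G i -> H}) :
  exists g : {multiplicative free_prod -> H},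
    forall i (a : G i), g (free_prod_inj a) = f i a.
Proof.
have [|g gE] := @pres_lift _ free_prod_rel H (fun t => f (tag t) (tagged t)).
  move=> _ _ [i [a [b [-> ->]]]].
  by rewrite /word_eval !big_cons big_nil /= !mulg1 gmulfM.
by exists g => i a; rewrite gE.
Qed.

End FreeProduct.

Section TorusType.
Variables (m : nat) (p : 'I_m -> nat).

Definition Gamma_rel (u v : word 'I_m) : Prop :=
  exists i j : 'I_m, u = nseq (p i) (i, false) /\ v = nseq (p j) (j, false).

Definition Gamma := presented Gamma_rel.

HB.instance Definition _ := Group.on Gamma.

Definition Gamma_gen (j : 'I_m) : Gamma := pres_gen Gamma_rel j.

(* 'Z_k has order k only for k > 1; its group law in group_scope is addition
   modulo k. *)
Definition cyclic_factor (j : 'I_m) : groupType := 'Z_(p j).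

Definition cyclic_free_prod := free_prod cyclic_factor.

HB.instance Definition _ := Group.on cyclic_free_prod.

Definition sends_gens_to_generators (Phi : Gamma -> cyclic_free_prod) : Prop :=
  forall j : 'I_m, exists2 c : 'Z_(p j),
    generator [set: 'Z_(p j)] c &
    Phi (Gamma_gen j) = free_prod_inj (c : cyclic_factor j).

End TorusType.

Definition group_Hom (G H : groupType) : set (G -> H) :=
  [set f | {morph f : x y / x * y}]%classic.

Arguments group_Hom : clear implicits.

Definition group_Hom_factoring (G K H : groupType) (Phi : G -> K) :
    set (G -> H) :=
  [set rho | group_Hom G H rho /\
    exists2 rhobar : K -> H, group_Hom K H rhobar & rho = rhobar \o Phi]%classic.

Arguments group_Hom_factoring {G K} H Phi _.

(* The cardinal of a finite set; 0 by convention if A is infinite, which does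
   not happen for the sets of homomorphisms below (finite_group_Hom_Gamma). *)
Definition card_set (T : choiceType) (A : set T) : nat := #|` fset_set A|.

Lemma finite_group_Hom_Gamma m (p : 'I_m -> nat) (H : finGroupType) :
  finite_set (group_Hom (Gamma p) H).
Proof.
pose ev (f : Gamma p -> H) := [ffun j : 'I_m => f (Gamma_gen p j)].
pose back t := xget (fun=> 1) [set f | group_Hom (Gamma p) H f /\ ev f = t]%classic.
apply: (@sub_finite_set _ _ (back @` setT)%classic); last first.
  by apply/finite_image/finite_finset.
move=> f fM; exists (ev f) => //; rewrite /back.
case: xgetP => [g _ [gM /ffunP gf]|/(_ f)]; last by case.
by apply: pres_morph_ext => // j; have := gf j; rewrite !ffunE.
Qed.

Lemma Gamma_relP m (p : 'I_m -> nat) (i j : 'I_m) :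
  Gamma_gen p i ^+ p i = Gamma_gen p j ^+ p j.
Proof.
by rewrite -!pres_class_nseq; apply/pres_classP/WordRel; exists i, j.
Qed.

Lemma sends_gens_to_generators_exists m (p : 'I_m -> nat) :
    (forall j, 1 < p j)%N ->
  exists Phi : {multiplicative Gamma p -> cyclic_free_prod p},
    sends_gens_to_generators Phi.
Proof.
move=> p_gt1.
pose c j : 'Z_(p j) := Zp1.
have c_gen j : generator [set: 'Z_(p j)] (c j).
  by rewrite /generator /c Zp_cycle.
have [|Phi PhiE] := @pres_lift _ (Gamma_rel p) (cyclic_free_prod p)
    (fun j => free_prod_inj (c j : cyclic_factor p j)); last first.
  by exists Phi => j; exists (c j); rewrite // PhiE.
suff ev j : word_eval (fun j => free_prod_inj (c j : cyclic_factor p j))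
    (nseq (p j) (j, false)) = 1.
  by move=> _ _ [i [j [-> ->]]]; rewrite !ev.
have ->: word_eval (fun j => free_prod_inj (c j : cyclic_factor p j))
    (nseq (p j) (j, false)) = free_prod_inj (c j : cyclic_factor p j) ^+ p j.
  rewrite /word_eval; elim: (p j) => [|k IHk]; first by rewrite big_nil.
  by rewrite /= big_cons IHk expgS.
rewrite -free_prod_injX -[RHS](@free_prod_inj1 _ _ j); congr free_prod_inj.
apply: (@eqP _ (_ ^+ _) _); rewrite -order_dvdn.
suff -> : #[c j] = p j by [].
by rewrite order_Zp1 Zp_cast.
Qed.

Lemma sends_gens_to_generators_surj m (p : 'I_m -> nat)
    (Phi : {multiplicative Gamma p -> cyclic_free_prod p}) :
  sends_gens_to_generators Phi -> forall y, exists x, Phi x = y.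
Proof.
move=> PhiP.
have Phi1 : Phi 1 = 1 by apply: (mulgI (Phi 1)); rewrite -gmulfM !mulg1.
have PhiV x : Phi x^-1 = (Phi x)^-1.
  by apply: (mulgI (Phi x)); rewrite -gmulfM !mulgV.
have PhiX x k : Phi (x ^+ k) = Phi x ^+ k.
  by elim: k => [|k IHk]; rewrite ?expg0 // !expgS gmulfM IHk.
have im_gen t : exists x, Phi x = pres_gen _ t.
  case: t => j a; have [c c_gen Phi_c] := PhiP j.
  have /cycleP[k ak] : (a : 'Z_(p j)) \in <[c]>.
    by rewrite -(eqP c_gen) inE.
  exists (Gamma_gen p j ^+ k).
  by rewrite PhiX Phi_c -free_prod_injX -ak.
apply: pres_ind => [|t y [x <-]|t y [x <-]]; first by exists 1.
- by have [z <-] := im_gen t; exists (z * x); rewrite gmulfM.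
- by have [z <-] := im_gen t; exists (z^-1 * x); rewrite gmulfM PhiV.
Qed.

(* Main.v *)
Require Import Defs.
From HB Require Import structures.
From mathcomp Require Import all_boot all_order all_algebra all_fingroup.
From mathcomp Require Import all_solvable.
From mathcomp Require Import finmap boolp classical_sets functions cardinality.
From mathcomp Require Import reals topology normedtype sequences.
From mathcomp Require Import exp.
From mathcomp Require Import fintype perm finset.
From mathcomp Require Import zify lra.

Set Implicit Arguments.
Unset Strict Implicit.
Unset Printing Implicit Defensive.

Import Order.TTheory GRing.Theory Num.Theory numFieldNormedType.Exports.

(** Restriction to the generators identifies a homomorphism from Gamma to S_n
    with a tuple (x_j) such that all powers x_j^{p_j} are equal to one
    permutation s, and it factors through Phi exactly when s = 1.  Writing
    r_p(s) for the number of p-th roots of s in S_n and a_p(n) = r_p(1), one has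
    to show that E_n, the sum over s <> 1 of prod_j r_{p_j}(s) / a_{p_j}(n),
    tends to 0.

    Let s move k points and have c nontrivial cycles, so that 2c <= k.  A p-th
    root x of s commutes with s.  It therefore restricts to the fixed points of
    s and permutes the nontrivial cycles of s, both with p-th power 1; once
    these two permutations are known, x is determined by the images of one
    point in each nontrivial cycle, hence up to at most 2^k choices
    ([card_roots_le]):

      r_p(s) <= 2^k a_p(n - k) a_p(c).

    Two bounds on a_p are needed.
    - Upper bound ([card_torsion_le]): a permutation of c points with p-th
      power 1 has at least c/p cycles, and the sum of c^(number of cycles) over
      S_c is c (c+1) ... (2c-1) <= (2c)^c; hence a_p(c)^p c^c <= (2c)^(cp).
    - Growth ([card_torsion_setD1_le]): n a_p(n-1) / a_p(n) is the mean number
      of fixed points of a random permutation with p-th power 1.  Replacing p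
      fixed points by a p-cycle shows that the p-th factorial moment of this
      number is at most n, so the mean is O(n^(1/p)); removing k points one at
      a time bounds a_p(n - k) / a_p(n).

    Together they give r_p(s) / a_p(n) <= K^k t^(1 - 1/p), where t is
    c^c / (n (n-1) ... (n-k+1)).  The product over j has the exponent
    m - sum_j 1/p_j = 1 + delta with delta > 0.  As c <= k/2, t is at most
    4^k k^c / n^k and t^2 is at most (16/n)^k, so the product is at most
    (C n^(-delta/2))^k k^c / n^k.  The sum of k^c over the permutations moving
    exactly k points is at most (8n)^k, by the same cycle count as above, and
    E_n is dominated by the geometric series of 8 C n^(-delta/2), which tends
    to 0. *)

(** * Permutations counted by cycles *)

Lemma finset_ind (T : finType) (P : {set T} -> Prop) : P set0 ->
  (forall (S : {set T}) a, a \notin S -> P S -> P (a |: S)%SET) ->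
  forall S, P S.
Proof.
move=> P0 PU S; have [n] := ubnP #|S|; elim: n S => // n IH S.
have [->|[a aS] ltSn] := set_0Vmem S; first by [].
rewrite -(setD1K aS); apply: PU; first by rewrite !inE eqxx.
by apply: IH; move: ltSn; rewrite (cardsD1 a) aS.
Qed.

Section CycleCount.
Local Open Scope group_scope.
Variable T : finType.
Implicit Types (S : {set T}) (s t : {perm T}).

Lemma SymP S s : reflect (forall x, x \notin S -> s x = x) (s \in Sym S).
Proof.
rewrite inE; apply: (iffP subsetP) => fixS x; last first.
  by rewrite inE; apply: contraNT => /fixS/eqP.
by move=> xS; apply/eqP; apply: contraNT xS => /(fixS x).
Qed.

Lemma Sym_setT s : s \in Sym [set: T].
Proof. by apply/SymP => x; rewrite inE. Qed.

Lemma Sym_stable S s x : s \in Sym S -> (s x \in S) = (x \in S).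
Proof. by rewrite inE => /perm_closed ->. Qed.

Lemma porbit_fix s x : s x = x -> porbit s x = [set x].
Proof.
move=> sx; apply/setP => y; rewrite inE.
apply/porbitP/eqP => [[i ->]|->]; last by exists 0%N; rewrite expg0 perm1.
by elim: i => [|i IH]; rewrite ?expg0 ?perm1 // expgS permM sx.
Qed.

Lemma porbit_stable S s x y :
  s \in Sym S -> y \in porbit s x -> (y \in S) = (x \in S).
Proof. by move=> sS /porbitP[i ->]; rewrite Sym_stable ?groupX. Qed.

(** Meant for [s] supported in [S], so that the cycles through [S] stay inside. *)
Definition cycles_in S s := #|porbit s @: S|.

Lemma card_porbits_Sym S s :
  s \in Sym S -> #|porbits s| = (cycles_in S s + #|~: S|)%N.
Proof.
move=> sS; have fixS x : x \in ~: S -> porbit s x = [set x].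
  by rewrite inE => xS; apply/porbit_fix/(SymP _ _ sS).
have -> : #|~: S| = #|porbit s @: (~: S)|.
  by rewrite card_in_imset // => x y xS yS; rewrite !fixS // => /set1_inj.
rewrite /porbits /cycles_in -cardsUI.
have -> : (porbit s @: S) :&: (porbit s @: (~: S)) = set0.
  apply/setP => C; rewrite !inE; apply/andP => -[/imsetP[x xS ->]].
  move=> /imsetP[y yS Exy]; move: (yS); rewrite inE => /negP; apply.
  by rewrite (porbit_stable sS (x := x)) // Exy porbit_id.
rewrite cards0 addn0 -imsetU setUCr; apply: eq_card => C.
by apply/imsetP/imsetP => -[x _ ->]; exists x.
Qed.

Lemma cycles_in_setU1 S s a :
  a \notin S -> s \in Sym S -> cycles_in (a |: S) s = (cycles_in S s).+1.
Proof.
move=> aS sS; have sS' : s \in Sym (a |: S).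
  by apply/SymP => x; rewrite !inE negb_or => /andP[_]; apply: (SymP _ _ sS).
have := card_porbits_Sym sS; rewrite (card_porbits_Sym sS').
by have := cardsC S; have := cardsC (a |: S); rewrite cardsU1 aS /=; lia.
Qed.

(** A permutation [u] of [a |: S] is uniquely [tperm a y * s] with [s] supported
    in [S]: the point [y] has to be the preimage of [a] under [u]. *)
Lemma mul_tperm_Sym S s a y : a \notin S -> y \in a |: S ->
  (tperm a y * s \in Sym (a |: S)) && ((tperm a y * s)^-1 a == y)
    = (s \in Sym S).
Proof.
move=> aS yS; apply/andP/idP => [[uS /eqP uy]|sS].
  apply/SymP => x xS; have [->|xa] := eqVneq x a.
    by rewrite -[in RHS](permKV (tperm a y * s) a) uy permM tpermR.
  have xS' : x \notin a |: S by rewrite !inE negb_or xa.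
  have := SymP _ _ uS x xS'; rewrite permM tpermD //; first by rewrite eq_sym.
  by apply: contraNneq xS' => <-.
have sS' : s \in Sym (a |: S).
  by apply/SymP => x; rewrite !inE negb_or => /andP[_]; apply: (SymP _ _ sS).
split.
  rewrite groupM // inE; apply: subset_trans (tperm_on a y) _.
  by apply/subsetP => x; rewrite !inE => /orP[/eqP->|/eqP->];
     rewrite ?eqxx //; move: yS; rewrite !inE.
by apply/eqP/(@perm_inj _ (tperm a y * s)); rewrite permKV permM tpermR
  (SymP _ _ sS).
Qed.

(** The transposition inserts [a] into the cycle of [y]. *)
Lemma cycles_in_mul_tperm S s a y : a \notin S -> y \in S -> s \in Sym S ->
  cycles_in (a |: S) (tperm a y * s) = cycles_in S s.
Proof.
move=> aS yS sS; have yS' : y \in a |: S by rewrite !inE yS orbT.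
have /andP[uS _] : (tperm a y * s \in Sym (a |: S))
  && ((tperm a y * s)^-1 a == y) by rewrite mul_tperm_Sym.
have /= := porbits_mul_tperm s a y; rewrite (card_porbits_Sym uS).
rewrite (card_porbits_Sym sS) (porbit_sym s a y) porbit_fix ?(SymP _ _ sS) //.
rewrite inE; have -> : (y == a) = false by apply: contraNF aS => /eqP <-.
have -> : (a == y) = false by apply: contraNF aS => /eqP ->.
by have := cardsC S; have := cardsC (a |: S); rewrite cardsU1 aS /=; lia.
Qed.

Lemma sum_Sym_setU1 S a (F : {perm T} -> nat) : a \notin S ->
  (\sum_(s in Sym (a |: S)) F s
     = \sum_(s in Sym S) (F s + \sum_(y in S) F (tperm a y * s)%g))%N.
Proof.
move=> aS; rewrite (partition_big (fun s => s^-1 a) (mem (a |: S))) /=; last first.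
  by move=> s sS; rewrite Sym_stable ?groupV // !inE eqxx.
transitivity (\sum_(y in a |: S) \sum_(s in Sym S) F (tperm a y * s)%g)%N.
  apply: eq_bigr => y yS; rewrite (reindex_inj (mulgI (tperm a y))) /=.
  by apply: eq_bigl => s; rewrite mul_tperm_Sym.
rewrite big_setU1 //= tperm1 big_split /= [in RHS]exchange_big /=.
by congr addn; apply: eq_bigr => s _; rewrite mul1g.
Qed.

(** Adding a point [a] to [S] multiplies the sum by [X + #|S|]: either [a] is a
    new cycle, or it is inserted before one of the [#|S|] other points. *)
Lemma sum_Sym_cycles S X :
  (\sum_(s in Sym S) X ^ cycles_in S s = \prod_(i < #|S|) (X + i))%N.
Proof.
elim/finset_ind: S => [|S a aS IH].
  rewrite cards0 big_ord0 (big_pred1 1) => [|s /=].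
    by rewrite /cycles_in imset0 cards0.
  apply/SymP/eqP => [s1|-> x _]; last by rewrite perm1.
  by apply/permP => x; rewrite perm1 s1 // inE.
rewrite sum_Sym_setU1 // cardsU1 aS add1n big_ord_recr /= -IH big_distrl /=.
apply: eq_bigr => s sS; rewrite cycles_in_setU1 //.
rewrite (eq_bigr (fun=> X ^ cycles_in S s)%N) => [|y yS].
  by rewrite sum_nat_const expnS; nia.
by rewrite cycles_in_mul_tperm.
Qed.

Lemma sum_Sym_cycles_le S :
  (\sum_(s in Sym S) #|S| ^ cycles_in S s <= #|S|.*2 ^ #|S|)%N.
Proof.
rewrite sum_Sym_cycles -[X in (_ <= _ ^ X)%N]card_ord -prod_nat_const.
by apply: leq_prod => i _; have := ltn_ord i; lia.
Qed.

End CycleCount.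

(** * Permutations whose p-th power is trivial *)

Section Torsion.
Local Open Scope group_scope.
Variable T : finType.
Implicit Types (U V : {set T}) (s t : {perm T}).

Definition torsion p U := [set s in Sym U | s ^+ p == 1].

Lemma torsionP p U s : reflect (s \in Sym U /\ s ^+ p = 1) (s \in torsion p U).
Proof.
apply: (iffP idP) => [|[]]; rewrite !inE; first by case/andP=> -> /eqP.
by move=> -> ->; rewrite eqxx.
Qed.

Lemma card_torsion_gt0 p U : (0 < #|torsion p U|)%N.
Proof. by apply/card_gt0P; exists 1; apply/torsionP; rewrite group1 expg1n. Qed.

Lemma card_le_cycles p V s : (0 < p)%N -> s ^+ p = 1 ->
  (#|V| <= cycles_in V s * p)%N.
Proof.
move=> p0 sp; apply: (@leq_trans (\sum_(C in porbit s @: V) #|C|)%N).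
  apply: (@leq_trans #|cover (porbit s @: V)|); last by rewrite leq_card_cover.
  apply/subset_leq_card/subsetP => x xV; apply/bigcupP.
  by exists (porbit s x); [apply: imset_f | apply: porbit_id].
rewrite /cycles_in -sum_nat_const; apply: leq_sum => _ /imsetP[x _ ->].
rewrite porbit.unlock; apply: leq_trans (leq_imset_card _ _) _.
by rewrite -/#[s] dvdn_leq // order_dvdn sp.
Qed.

(** An element of [torsion p V] has at least [#|V| / p] cycles, so it contributes
    at least [#|V| ^ (#|V| / p)] to the sum of [sum_Sym_cycles_le].  The inequality
    is raised to the power [p] to stay within integers. *)
Lemma card_torsion_le p V : (0 < p)%N ->
  (#|torsion p V| ^ p * #|V| ^ #|V| <= (#|V|.*2 ^ #|V|) ^ p)%N.
Proof.
move=> p0; set c := #|V|; pose k := ((c + p.-1) %/ p)%N.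
have kP s : s \in torsion p V -> (k <= cycles_in V s)%N.
  move=> /torsionP[_ /(card_le_cycles V p0) cP].
  have : (k < (cycles_in V s).+1)%N by rewrite ltn_divLR //; lia.
  by rewrite ltnS.
have le_k : (c <= k * p)%N.
  by have := divn_eq (c + p.-1) p; have := ltn_pmod (c + p.-1) p0;
     rewrite -/k; lia.
have aM : (#|torsion p V| * c ^ k <= c.*2 ^ c)%N.
  apply: leq_trans (sum_Sym_cycles_le V); rewrite -sum_nat_const.
  rewrite big_mkcond [X in (_ <= X)%N]big_mkcond /=; apply: leq_sum => s _.
  case: ifP => // sV; have /torsionP[-> _] := sV; have := kP s sV.
  case: (posnP #|V|) => [c0|c_gt0 kc]; last by rewrite leq_pexp2l.
  rewrite /k c0 /= /cycles_in; move/cards0_eq: c0 => ->.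
  by rewrite imset0 cards0 /= leqn0 => /eqP ->.
move: aM; rewrite -(leq_exp2r _ _ p0); apply: leq_trans.
rewrite expnMn leq_mul2l; apply/orP; right.
rewrite -expnM; case: (posnP c) => [c0|c_gt0]; last by rewrite leq_pexp2l.
rewrite c0 expn0; case: (posnP (k * p)) => [->|] //.
by rewrite /k c0 add0n divn_small ?mul0n // prednK.
Qed.

End Torsion.

Lemma rearrangement2 a b k : (a * b ^ k + b * a ^ k <= a ^ k.+1 + b ^ k.+1)%N.
Proof.
wlog le_ab : a b / (a <= b)%N.
  by move=> H; case: (leqP a b) => [|/ltnW] /H //; rewrite addnC [leqRHS]addnC.
rewrite !expnS; have : (a ^ k <= b ^ k)%N.
  by case: k => // k; rewrite leq_exp2r.
by move: (a ^ k)%N (b ^ k)%N => u v uv; nia.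
Qed.

(** By induction on [k], from the sum form of [rearrangement2] over all pairs of
    indices (Chebyshev's sum inequality). *)
Lemma power_mean (I : finType) (A : {pred I}) (F : I -> nat) k :
  ((\sum_(i in A) F i) ^ k.+1 <= #|A| ^ k * \sum_(i in A) F i ^ k.+1)%N.
Proof.
elim: k => [|k IH]; first by rewrite expn1 expn0 mul1n.
rewrite expnS; apply: leq_trans (leq_mul (leqnn _) IH) _.
rewrite mulnCA expnSr -mulnA leq_mul2l; apply/orP; right.
have sum2 (G H : I -> nat) :
    ((\sum_(i in A) G i) * (\sum_(i in A) H i)
      + (\sum_(i in A) G i) * \sum_(i in A) H i
    = \sum_(i in A) \sum_(j in A) (G i * H j + G j * H i))%N.
  under [RHS]eq_bigr do rewrite big_split /=.
  rewrite big_split /= [X in (_ = _ + X)%N]exchange_big /= big_distrl /=.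
  by congr addn; apply: eq_bigr => i _; rewrite big_distrr.
have -> : #|A| = (\sum_(i in A) 1)%N by rewrite sum1_card.
rewrite -(leq_pmul2l (isT : (0 < 2)%N)) !mul2n -!addnn !sum2.
apply: leq_sum => i _; apply: leq_sum => j _.
by rewrite !mul1n [leqRHS]addnC; apply: rearrangement2.
Qed.

(** The ordinary [p]-th moment is controlled by the factorial one, up to a
    constant accounting for small [n]: if [2p <= n], every factor [n - i] of the
    falling factorial is at least [n / 2]. *)
Lemma expn_le_ffact n p : (n ^ p <= p.*2 ^ p + 2 ^ p * n ^_ p)%N.
Proof.
case: (ltnP n p.*2) => [lt_n|le_n].
  apply: leq_trans (leq_addr _ _); case: p lt_n => // p lt_n.
  by rewrite leq_exp2r // ltnW.
have powE x : (x ^ p = \prod_(i < p) x)%N by rewrite prod_nat_const card_ord.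
apply: leq_trans (leq_addl _ _); rewrite ffact_prod !powE -big_split /=.
apply: leq_prod => i _.
by have := ltn_ord i; lia.
Qed.

(** * Insertion of a cycle and the number of fixed points *)

Section CyclePerm.
Local Open Scope group_scope.
Variable T : finType.
Implicit Types (c : seq T) (s : {perm T}) (S U : {set T}).

(** Removing duplicates makes the definition total. *)
Definition cycle_perm c : {perm T} :=
  perm (can_inj (prev_next (undup_uniq c))).

Lemma cycle_permE c : uniq c -> cycle_perm c =1 next c.
Proof. by move=> Uc x; rewrite permE undup_id. Qed.

Lemma cycle_perm_Sym c : uniq c -> cycle_perm c \in Sym [set x in c].
Proof.
move=> Uc; apply/SymP => x; rewrite inE => xc.
by rewrite cycle_permE // next_nth (negPf xc).
Qed.

Lemma cycle_permX c : uniq c -> cycle_perm c ^+ size c = 1.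
Proof.
move=> Uc; apply/permP => x; rewrite perm1 permX.
have [xc|xc] := boolP (x \in c); last first.
  elim: (size c) => //= n ->; apply: (SymP _ _ (cycle_perm_Sym Uc)).
  by rewrite inE.
rewrite (eq_iter (cycle_permE Uc)) -(order_cycle (cycle_next Uc) Uc xc).
by rewrite (iter_order_cycle (cycle_next Uc)).
Qed.

(** If [s] fixes the entries of [x :: c], this list can be read off from the
    product of [s] with the corresponding cycle by iterating from [x]. *)
Lemma mul_cycle_perm_traject s x c : uniq (x :: c) ->
  (forall y, y \in x :: c -> s y = y) ->
  x :: c = traject (s * cycle_perm (x :: c)) x (size c).+1.
Proof.
move=> Uc fixs; rewrite -fcycle_consE //.
rewrite (@eq_in_cycle _ (mem (x :: c)) _ (frel (next (x :: c)))) //.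
- exact: cycle_next.
- by move=> y z yc _; rewrite /= permM fixs // cycle_permE.
- exact/allP.
Qed.

Definition fixed_in U s := [set y in U | s y == y].

(** The sum counts the pairs of a permutation [s] and a list of [p.+1] distinct
    fixed points of [s].  Turning the list into a cycle gives another element of
    [torsion p.+1 U], from which [s] and the list are recovered once the first
    point of the list is known. *)
Lemma sum_ffact_fixed p U :
  (\sum_(s in torsion p.+1 U) #|fixed_in U s| ^_ p.+1
     <= #|torsion p.+1 U| * #|U|)%N.
Proof.
pose P := [pred u : {perm T} * p.+1.-tuple T |
  (u.1 \in torsion p.+1 U) && (all (mem (fixed_in U u.1)) u.2 && uniq u.2)].
have -> : (\sum_(s in torsion p.+1 U) #|fixed_in U s| ^_ p.+1 = #|P|)%N.
  rewrite -sum1_card -(pair_big_dep (mem (torsion p.+1 U))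
    (fun s (t : p.+1.-tuple T) => all (mem (fixed_in U s)) t && uniq t)
    (fun _ _ => 1%N)) /=.
  apply: eq_bigr => s _; rewrite -card_uniq_tuples sum1_card.
  by apply: eq_card => t; rewrite !inE.
pose f (u : {perm T} * p.+1.-tuple T) := (u.1 * cycle_perm u.2, thead u.2).
have PE u : u \in P -> [/\ u.1 \in Sym U, u.1 ^+ p.+1 = 1, uniq u.2,
    {subset u.2 <= U} & forall y, y \in tval u.2 -> u.1 y = y].
  rewrite [u \in P]inE => /andP[/torsionP[uU u1] /andP[/allP uF Uu]].
  split=> // y yu; first by have := uF y yu; rewrite !inE => /andP[].
  by have := uF y yu; rewrite !inE => /andP[_ /eqP].
rewrite -cardsX -(card_in_imset (f := f) (D := P)); last first.
  move=> [s t] [s' t'] /PE[/= _ _ Ut _ st] /PE[/= _ _ Ut' _ st'] [] Es Ex.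
  have Et : t = t'.
    apply: val_inj; case/tupleP: t Ut st Es Ex => x t Ut st Es.
    case/tupleP: t' Ut' st' Es => x' t' Ut' st' Es; rewrite !theadE => Ex.
    rewrite /= in Es Ut Ut' st st' *.
    rewrite (mul_cycle_perm_traject Ut st) (mul_cycle_perm_traject Ut' st').
    by rewrite !size_tuple Es Ex.
  by rewrite Et in Es *; rewrite (mulIg _ _ _ Es).
apply/subset_leq_card/subsetP => _ /imsetP[[s t] /PE[/= sU s1 Ut tU st] ->].
have cU : cycle_perm t \in Sym U.
  apply/SymP => x xU; apply: (SymP _ _ (cycle_perm_Sym Ut)).
  by rewrite inE; apply: contra xU => /tU.
rewrite inE /=; apply/andP; split; last by apply/tU/mem_tnth.
apply/torsionP; split; first by rewrite groupM.
rewrite expgMn; first by rewrite s1 mul1g -[X in _ ^+ X](size_tuple t) cycle_permX.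
apply: (@perm_onC _ (~: [set x in tval t]) [set x in tval t]).
- apply/subsetP => x; rewrite !inE; apply: contraNN => xt; exact/eqP/st.
- by have := cycle_perm_Sym Ut; rewrite inE.
- by rewrite -setI_eq0 setIC setICr.
Qed.

Lemma torsion_setD1 p U z :
  torsion p (U :\ z) = [set s in torsion p U | s z == z].
Proof.
apply/setP => s; rewrite [RHS]inE; apply/torsionP/andP.
  case=> sU sp; split; last by apply/eqP/(SymP _ _ sU); rewrite !inE eqxx.
  apply/torsionP; split=> //; apply/SymP => x xU.
  by apply: (SymP _ _ sU); rewrite !inE negb_and xU orbT.
case=> /torsionP[sU sp] /eqP sz; split=> //; apply/SymP => x.
by rewrite !inE negb_and negbK => /orP[/eqP->|/(SymP _ _ sU)].
Qed.

(** Conjugation by the transposition of [y] and [z]. *)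
Lemma card_torsion_setD1_eq p U y z : y \in U -> z \in U ->
  #|torsion p (U :\ y)| = #|torsion p (U :\ z)|.
Proof.
suff le y' z' : y' \in U -> z' \in U ->
    (#|torsion p (U :\ y')| <= #|torsion p (U :\ z')|)%N.
  by move=> yU zU; apply/eqP; rewrite eqn_leq !le.
move=> yU zU; rewrite -(card_imset _ (@conjg_inj _ (tperm y' z'))).
apply/subset_leq_card/subsetP => _ /imsetP[s + ->].
rewrite !torsion_setD1 !inE => /andP[/andP[sU /eqP sp] /eqP sy].
rewrite -conjXg sp conj1g eqxx andbT; apply/andP; split; last first.
  by have := permJ s (tperm y' z') y'; rewrite sy tpermL => ->.
have tU : tperm y' z' \in Sym U.
  rewrite inE; apply: subset_trans (tperm_on _ _) _.
  by apply/subsetP => x; rewrite !inE => /orP[/eqP->|/eqP->].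
have : s \in Sym U by rewrite inE.
by move=> /groupJ/(_ tU); rewrite inE.
Qed.

(** Double counting of the pairs of a permutation and one of its fixed points. *)
Lemma sum_fixed p U y : y \in U ->
  (\sum_(s in torsion p U) #|fixed_in U s| = #|U| * #|torsion p (U :\ y)|)%N.
Proof.
move=> yU; rewrite -sum_nat_const.
under eq_bigr => s _ do rewrite -sum1_card.
rewrite (exchange_big_dep (mem U)) /=; last by move=> s z _; rewrite inE => /andP[].
apply: eq_bigr => z zU; rewrite (card_torsion_setD1_eq p yU zU).
rewrite sum1dep_card torsion_setD1; apply: eq_card => s.
by rewrite !inE zU.
Qed.

(** The two constants of [expn_le_ffact] added up. *)
Definition torsion_ratio p := (p.*2 ^ p + 2 ^ p)%N.

(** [#|U| * #|torsion p (U :\ y)|] is the first moment of the number of fixed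
    points on [torsion p U].  Its [p]-th power is at most [#|torsion p U| ^ p.-1]
    times the [p]-th moment, and the latter is [O(#|U| * #|torsion p U|)] by
    [sum_ffact_fixed]. *)
Lemma card_torsion_setD1_le p U y : (0 < p)%N -> y \in U ->
  (#|U| ^ p.-1 * #|torsion p (U :\ y)| ^ p
     <= torsion_ratio p * #|torsion p U| ^ p)%N.
Proof.
case: p => // p _ yU /=; have U0 : (0 < #|U|)%N by apply/card_gt0P; exists y.
rewrite -(leq_pmul2l U0) mulnA -expnS -expnMn -sum_fixed //.
apply: leq_trans (power_mean _ _ _) _; rewrite expnSr mulnCA mulnCA.
rewrite [(_ * (_ * #|torsion _ _|))%N]mulnCA mulnCA leq_mul2l; apply/orP; right.
apply: (@leq_trans (\sum_(s in torsion p.+1 U)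
    (p.+1.*2 ^ p.+1 + 2 ^ p.+1 * #|fixed_in U s| ^_ p.+1))%N).
  by apply: leq_sum => s _; apply: expn_le_ffact.
rewrite big_split /= sum_nat_const -big_distrr /=.
apply: leq_trans (leq_add (leqnn _) (leq_mul (leqnn _) (sum_ffact_fixed p U))) _.
rewrite /torsion_ratio; move: (_ ^ _)%N (2 ^ _)%N #|torsion _ _| => u v w; nia.
Qed.

(** The points of [S] are removed one at a time; the factors [#|U|] of
    [card_torsion_setD1_le] multiply to a falling factorial. *)
Lemma card_torsion_setC_le p S : (0 < p)%N ->
  (#|torsion p (~: S)| ^ p * (#|T| ^_ #|S|) ^ p.-1
     <= torsion_ratio p ^ #|S| * #|torsion p [set: T]| ^ p)%N.
Proof.
move=> p0; elim/finset_ind: S => [|S a aS IH].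
  by rewrite setC0 cards0 ffactn0 exp1n muln1 expn0 mul1n.
rewrite cardsU1 aS add1n ffactnSr expnMn.
have -> : ~: (a |: S) = ~: S :\ a.
  by apply/setP => x; rewrite !inE negb_or.
have -> : (#|T| - #|S|)%N = #|~: S| by rewrite -(cardsC S) addKn.
have aS' : a \in ~: S by rewrite inE.
have le1 := card_torsion_setD1_le p0 aS'.
rewrite [(_ ^ p * _)%N]mulnC -mulnA; apply: leq_trans (leq_mul (leqnn _) le1) _.
by rewrite mulnCA expnS -mulnA leq_mul2l mulnC IH orbT.
Qed.

End CyclePerm.

(** * Roots of a permutation *)

Section Roots.
Local Open Scope group_scope.
Variable T : finType.
Implicit Types (s x y : {perm T}) (C : {set T}).

Definition roots p s := [set x : {perm T} | x ^+ p == s].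

Definition moved s := [set z | s z != z].

Definition long_cycles s := porbit s @: moved s.

Lemma moved_Sym s : s \in Sym (moved s).
Proof. by apply/SymP => z; rewrite inE negbK => /eqP. Qed.

Lemma long_cycleP s C :
  reflect (exists2 z, s z != z & C = porbit s z) (C \in long_cycles s).
Proof.
by apply: (iffP imsetP) => -[z sz ->]; exists z => //; move: sz; rewrite inE.
Qed.

Lemma card_long_cycle_ge2 s C : C \in long_cycles s -> (1 < #|C|)%N.
Proof.
move=> /long_cycleP[z sz ->]; apply/card_gt1P; exists (s z), z.
by rewrite porbit_id -{1}[s]expg1 mem_porbit; split.
Qed.

Lemma sum_card_long_cycles s :
  (\sum_(C in long_cycles s) #|C| = #|moved s|)%N.
Proof.
have tI : trivIset (long_cycles s).
  apply/trivIsetP => _ _ /long_cycleP[y sy ->] /long_cycleP[z sz ->].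
  apply: contraR; rewrite -setI_eq0 => /set0Pn[w]; rewrite inE.
  by rewrite -!eq_porbit_mem => /andP[/eqP <-].
rewrite (eqP tI) /cover; apply: eq_card => z; apply/bigcupP/idP => [|sz].
  move=> [_ /long_cycleP[y sy ->] zy].
  by rewrite (porbit_stable (moved_Sym s) zy) inE.
by exists (porbit s z); rewrite ?porbit_id ?imset_f.
Qed.

Lemma card_long_cycles s : (#|long_cycles s|.*2 <= #|moved s|)%N.
Proof.
rewrite -sum_card_long_cycles -muln2 -sum_nat_const.
by apply: leq_sum => C /card_long_cycle_ge2.
Qed.

Lemma prod_card_long_cycles s :
  (\prod_(C in long_cycles s) #|C| <= 2 ^ #|moved s|)%N.
Proof.
rewrite -sum_card_long_cycles expn_sum; apply: leq_prod => C _.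
exact/ltnW/ltn_expl.
Qed.

Definition perm_on_sets x : {perm {set T}} := actperm ('P^*) x.

Lemma perm_on_setsE x C : perm_on_sets x C = x @: C.
Proof. by rewrite /perm_on_sets actpermE /= setactE. Qed.

Lemma perm_on_setsX x n : perm_on_sets (x ^+ n) = perm_on_sets x ^+ n.
Proof. by rewrite /perm_on_sets (morphX (actperm_morphism _)) ?inE. Qed.

(** A permutation commuting with [s] permutes the fixed points of [s], and also
    its nontrivial cycles. *)
Section Centralizer.
Variables (s x : {perm T}).
Hypothesis sx : commute s x.

Lemma commute_perm i z : x ((s ^+ i) z) = (s ^+ i) (x z).
Proof. by rewrite -!permM (commuteX i (commute_sym sx)). Qed.

Lemma imset_porbit z : x @: porbit s z = porbit s (x z).
Proof.
apply/setP => w; apply/imsetP/porbitP => [[_ /porbitP[i ->] ->]|[i ->]].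
  by exists i; rewrite commute_perm.
by exists ((s ^+ i) z); rewrite ?mem_porbit ?commute_perm.
Qed.

Lemma moved_commute z : (s (x z) != x z) = (s z != z).
Proof. by have := commute_perm 1 z; rewrite expg1 => <-; rewrite (inj_eq perm_inj). Qed.

Lemma astabs_fixed : x \in 'N(~: moved s | 'P).
Proof. by apply/astabsP => z; rewrite !inE /= /aperm moved_commute. Qed.

Lemma astabs_long_cycles : perm_on_sets x \in 'N(long_cycles s | 'P).
Proof.
rewrite inE in_setT inE; apply/subsetP => _ /long_cycleP[z sz ->].
rewrite inE /= /aperm perm_on_setsE imset_porbit imset_f //.
by rewrite inE moved_commute.
Qed.

End Centralizer.

(** What is kept of a [p]-th root of [s]: two permutations with trivial [p]-th
    power, see [root_shadow_torsion]. *)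
Definition root_shadow s x :=
  (restr_perm (~: moved s) x, restr_perm (long_cycles s) (perm_on_sets x)).

Lemma rootsP p s x : reflect (x ^+ p = s) (x \in roots p s).
Proof. by rewrite inE; apply: eqP. Qed.

Lemma commute_roots p s x : x \in roots p s -> commute s x.
Proof. by move/rootsP <-; apply/commute_sym/commuteX. Qed.

Lemma root_shadow_torsion p s x : x \in roots p s ->
  root_shadow s x \in setX (torsion p (~: moved s)) (torsion p (long_cycles s)).
Proof.
move=> xs; have sx := commute_roots xs; have ss : commute s s by [].
move/rootsP: xs => xs; rewrite inE /=; apply/andP; split; apply/torsionP; split.
- by rewrite inE restr_perm_on.
- rewrite -morphX ?astabs_fixed // xs; apply/permP => z; rewrite perm1.
  have [zF|zF] := boolP (z \in ~: moved s); last first.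
    by apply: (out_perm (restr_perm_on _ _)).
  rewrite restr_permE ?astabs_fixed //.
  by move: zF; rewrite !inE negbK => /eqP.
- by rewrite inE restr_perm_on.
rewrite -morphX ?astabs_long_cycles // -perm_on_setsX xs.
apply/permP => C; rewrite perm1.
have [CV|CV] := boolP (C \in long_cycles s); last first.
  by apply: (out_perm (restr_perm_on _ _)).
rewrite restr_permE ?astabs_long_cycles // perm_on_setsE.
have /long_cycleP[z _ ->] := CV; rewrite imset_porbit //.
by apply/eqP; rewrite eq_porbit_mem -{1}[s]expg1 mem_porbit.
Qed.

(** As [x] commutes with [s], its values on a cycle [C] of [s] follow from its
    value at one point of [C].  The second component of the shadow prescribes the
    cycle containing this value, which leaves at most [#|C|] choices. *)
Lemma card_root_shadow_fiber p s (b : {perm T} * {perm {set T}}) :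
  (#|[set x in roots p s | root_shadow s x == b]|
     <= \prod_(C in long_cycles s) #|C|)%N.
Proof.
set A := [set x in _ | _]; have [->|[x0 x0A]] := set_0Vmem A.
  by rewrite cards0.
(* g x records the image under x of one chosen point in each long cycle. *)
pose g x := [ffun C : {set T} =>
  if C \in long_cycles s then omap (fun z => x z) [pick z in C] else None].
have AP x : x \in A -> [/\ commute s x, restr_perm (~: moved s) x = b.1 &
    restr_perm (long_cycles s) (perm_on_sets x) = b.2].
  by rewrite inE => /andP[/commute_roots sx /eqP <-].
have gI : {in A &, injective g}.
  move=> x y /AP[sx x1 x2] /AP[sy y1 y2] /ffunP gxy; apply/permP => z.
  have [zF|zS] := boolP (z \in ~: moved s).
    have := congr1 (fun u : {perm T} => u z) (etrans x1 (esym y1)).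
    by rewrite !restr_permE ?astabs_fixed.
  have CV : porbit s z \in long_cycles s.
    by apply/imset_f; move: zS; rewrite inE negbK.
  have := gxy (porbit s z); rewrite !ffunE CV.
  case: pickP => [w|/(_ z)]; last by rewrite /= porbit_id.
  (* z is a power of s applied to the chosen point w of its cycle. *)
  rewrite /= porbit_sym => /porbitP[i ->] [Ew].
  by rewrite !commute_perm // Ew.
rewrite -(card_in_imset gI).
apply: (@leq_trans #|pfamily None (mem (long_cycles s))
          (fun C => mem (@Some T @: (b.2 C)))|).
  apply/subset_leq_card/subsetP => _ /imsetP[x /AP[sx x1 x2] ->].
  apply/pfamilyP; split.
    by apply/supportP => C CV; rewrite ffunE (negPf CV).
  move=> C CV; rewrite ffunE; have -> : C \in long_cycles s := CV.
  case: pickP => [w wC|C0]; last first.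
    by have := card_long_cycle_ge2 CV; rewrite eq_card0.
  rewrite /= -x2 restr_permE ?astabs_long_cycles // perm_on_setsE.
  by rewrite !imset_f.
rewrite card_pfamily foldrE big_map big_enum /=; apply: leq_prod => C CV.
apply: leq_trans (leq_imset_card _ _) _.
have [sx _ <-] := AP x0 x0A.
by rewrite restr_permE ?astabs_long_cycles // perm_on_setsE leq_imset_card.
Qed.

(** Each of the possible shadows is the shadow of at most [2 ^ #|moved s|] roots. *)
Lemma card_roots_le p s : (#|roots p s| <= 2 ^ #|moved s|
  * (#|torsion p (~: moved s)| * #|torsion p (long_cycles s)|))%N.
Proof.
rewrite -sum1_card (partition_big (root_shadow s) (mem (setX
  (torsion p (~: moved s)) (torsion p (long_cycles s))))); last first.
  by move=> x; apply: root_shadow_torsion.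
rewrite -cardsX mulnC -sum_nat_const; apply: leq_sum => b _.
apply: leq_trans (prod_card_long_cycles s).
apply: leq_trans (card_root_shadow_fiber p s b); rewrite sum1dep_card.
by apply/subset_leq_card/subsetP => x; rewrite !inE.
Qed.

(** Both bounds on [torsion] inserted into [card_roots_le], raised to the power
    [p] and cleared of denominators. *)
Lemma card_roots_torsion_le p s : (0 < p)%N ->
  (#|roots p s| ^ p * (#|T| ^_ #|moved s|) ^ p.-1
    <= (2 ^ p * torsion_ratio p * 2 ^ p) ^ #|moved s|
       * (#|long_cycles s| ^ #|long_cycles s|) ^ p.-1
       * #|torsion p [set: T]| ^ p)%N.
Proof.
move=> p0; set c := #|long_cycles s|; set n := #|moved s|.
have cn : (c <= n)%N by have := card_long_cycles s; rewrite -/c -/n; lia.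
have c0 : (0 < c ^ c)%N by rewrite expn_gt0; case: (c).
have := card_roots_le p s; rewrite -(leq_exp2r _ _ p0) => r_le.
have := card_torsion_setC_le (moved s) p0; rewrite -/n => t_le.
have := card_torsion_le (long_cycles s) p0; rewrite -/c => u_le.
rewrite -(leq_pmul2r c0).
apply: (@leq_trans ((2 ^ n) ^ p * (torsion_ratio p ^ n * #|torsion p [set: T]| ^ p)
   * (c.*2 ^ c) ^ p)%N).
  apply: leq_trans (leq_mul (leq_mul r_le (leqnn _)) (leqnn _)) _.
  rewrite !expnMn; apply: leq_trans (leq_mul (leq_mul (leqnn _) t_le) u_le).
  move: (_ ^ p)%N (#|torsion p (~: _)| ^ p)%N (#|torsion p (long_cycles s)| ^ p)%N.
  by move: (_ ^ p.-1)%N (c ^ c)%N => *; lia.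
have -> : ((c.*2 ^ c) ^ p = 2 ^ (c * p) * (c ^ c) ^ p.-1 * c ^ c)%N.
  by rewrite -mul2n expnMn expnMn -expnM -mulnA -expnSr prednK.
apply: (@leq_trans ((2 ^ n) ^ p * (torsion_ratio p ^ n * #|torsion p [set: T]| ^ p)
   * (2 ^ (n * p) * (c ^ c) ^ p.-1 * c ^ c))%N).
  do 3?apply: leq_mul => //; by rewrite leq_pexp2l // leq_mul2r cn orbT.
rewrite !expnMn -!expnM [(p * n)%N]mulnC.
move: (2 ^ _)%N (_ ^ n)%N (_ ^ p)%N (c ^ _)%N (c ^ c)%N => *; lia.
Qed.

End Roots.

(** * Integer estimates for the sum over all permutations *)

Section Estimates.
Local Open Scope nat_scope.

Lemma bin_le_expn2 n k : 'C(n, k) <= 2 ^ n.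
Proof.
rewrite -[n]card_ord -card_draws -cardsT -card_powerset.
by apply/subset_leq_card/subsetP => A _; rewrite inE subsetT.
Qed.

(** [s ^ s] is at most the product [2s (2s-1) ... (s+1)], that is, [s`!] times a
    central binomial coefficient. *)
Lemma expnn_le_fact s : s ^ s <= 4 ^ s * s`!.
Proof.
apply: (@leq_trans (s.*2 ^_ s)); last first.
  by rewrite -bin_ffact leq_mul2r -[4]/(2 ^ 2) -expnM mul2n bin_le_expn2 orbT.
have powE x : x ^ s = \prod_(i < s) x by rewrite prod_nat_const card_ord.
rewrite ffact_prod powE; apply: leq_prod => i _.
by have := ltn_ord i; lia.
Qed.

(** Factor by factor, [n (s - i) <= s (n - i)], so [n ^ s / n ^_ s] is at most
    [s ^ s / s`!]. *)
Lemma expn_le_exp4_ffact n s : s <= n -> n ^ s <= 4 ^ s * n ^_ s.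
Proof.
move=> sn; have powE x : x ^ s = \prod_(i < s) x by rewrite prod_nat_const card_ord.
have le1 : n ^ s * s`! <= n ^_ s * s ^ s.
  rewrite -ffactnn !ffact_prod !powE -!big_split /=; apply: leq_prod => i _.
  by have := ltn_ord i; nia.
rewrite -(leq_pmul2r (fact_gt0 s)); apply: leq_trans le1 _.
by rewrite mulnC -mulnA [(n ^_ s * _)]mulnC mulnA leq_mul2r expnn_le_fact orbT.
Qed.

(** For each of the ['C(#|T|, s)] possible sets of moved points, the cycle count
    of [sum_Sym_cycles_le] bounds the sum by [(2s) ^ s]. *)
Lemma sum_long_cycles_le (T : finType) s :
  \sum_(x : {perm T} | #|moved x| == s) s ^ #|long_cycles x|
    <= 8 ^ s * #|T| ^ s.
Proof.
rewrite (partition_big (@moved T) (fun S => #|S| == s)) //=.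
apply: (@leq_trans (\sum_(S : {set T} | #|S| == s) s.*2 ^ s)).
  apply: leq_sum => S /eqP <-; apply: leq_trans (sum_Sym_cycles_le S).
  rewrite big_mkcond [leqRHS]big_mkcond; apply: leq_sum => x _ /=.
  case: ifP => // /andP[_ /eqP <-].
  by rewrite moved_Sym.
rewrite sum_nat_const -cardsE card_draws.
rewrite -mul2n expnMn -[8]/(2 * 4) expnMn -mulnA mulnCA leq_mul2l; apply/orP; right.
apply: leq_trans (leq_mul (leqnn _) (expnn_le_fact s)) _.
rewrite mulnCA leq_mul2l bin_ffact ffact_prod; apply/orP; right.
rewrite -[X in _ ^ X](card_ord s) -prod_nat_const.
by apply: leq_prod => i _; apply: leq_subr.
Qed.

End Estimates.

(** * The contribution of the nontrivial permutations *)

Section RealEstimates.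
Local Open Scope classical_set_scope.
Local Open Scope ring_scope.
Variable R : realType.

Definition root_const p : nat := (2 ^ p * torsion_ratio p * 2 ^ p)%N.

Lemma root_const_gt0 p : (0 < root_const p)%N.
Proof. by rewrite !muln_gt0 addn_gt0 !expn_gt0 /= !orbT. Qed.

(** The [p]-th root of [card_roots_torsion_le]; the root of the constant is
    replaced by the constant itself, which is at least 1. *)
Lemma root_ratio_le (T : finType) p (x : {perm T}) :
  (0 < p)%N ->
  #|roots p x|%:R / #|torsion p [set: T]|%:R
    <= (root_const p)%:R ^+ #|moved x|
       * ((#|long_cycles x| ^ #|long_cycles x|)%:R / (#|T| ^_ #|moved x|)%:R)
         `^ (1 - p%:R^-1) :> R.
Proof.
move=> p0; set s := #|moved x|; set c := #|long_cycles x|.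
set r := #|roots p x|; set a := #|torsion _ _|; set N := (#|T| ^_ s)%N.
have a0 : (0 : R) < a%:R by rewrite ltr0n card_torsion_gt0.
have N0 : (0 : R) < N%:R by rewrite ltr0n ffact_gt0 max_card.
have K1 : (1 : R) <= (root_const p)%:R ^+ s.
  by rewrite exprn_ege1 // ler1n root_const_gt0.
have p0' : (0 : R) < p%:R by rewrite ltr0n.
set t := _ / N%:R; have t0 : 0 <= t :> R by rewrite divr_ge0 ?ler0n.
have y0 : 0 <= r%:R / a%:R :> R by rewrite divr_ge0 ?ler0n.
have le_p : (r%:R / a%:R) ^+ p <= (root_const p)%:R ^+ s * t ^+ p.-1 :> R.
  rewrite !expr_div_n ler_pdivrMr ?exprn_gt0 // -[leRHS]mulrA.
  rewrite mulrAC mulrA ler_pdivlMr ?exprn_gt0 //.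
  rewrite -!natrX -!natrM ler_nat.
  by have := card_roots_torsion_le x p0; rewrite -/s -/c -/N -/r -/a /root_const; lia.
have -> : r%:R / a%:R = ((r%:R / a%:R) ^+ p) `^ p%:R^-1 :> R.
  by rewrite -powR_mulrn // -powRrM divff ?powRr1 // gt_eqF.
have /ge0_ler_powR le_pw : 0 <= p%:R^-1 :> R by rewrite invr_ge0 ltW.
apply: (le_trans (le_pw _ _ _ _ le_p)); rewrite ?nnegrE ?exprn_ge0 //.
  by rewrite mulr_ge0 ?exprn_ge0 ?ler0n.
rewrite powRM ?exprn_ge0 ?ler0n //; apply: ler_pM; rewrite ?powR_ge0 //.
  rewrite -[leRHS]powRr1 ?exprn_ge0 ?ler0n //; apply: ler_powR => //.
  by rewrite invf_le1 // ler1n.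
rewrite -powR_mulrn // -powRrM le_eqVlt; apply/predU1P; left; congr powR.
rewrite -[in LHS](prednK p0) -[in RHS](prednK p0) /=.
have : (p.-1.+1)%:R != 0 :> R by rewrite pnatr_eq0.
by move: (p.-1) => q q0; rewrite -{1}(addrK 1 q%:R) natr1 mulrBl divff // mul1r.
Qed.

Lemma prod_powR (I : finType) (t : R) (F : I -> R) : 0 < t ->
  \prod_i t `^ (F i) = t `^ (\sum_i F i).
Proof.
move=> t0; elim/big_rec2: _ => [|i x y _ ->]; first by rewrite powRr0.
by rewrite powRD // (gt_eqF t0) implybT.
Qed.

Variables (m : nat) (p : 'I_m -> nat).
Hypothesis p_gt1 : forall j, (1 < p j)%N.
Let delta : R := m%:R - 1 - \sum_(j < m) (p j)%:R^-1.
Hypothesis delta_gt0 : 0 < delta.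

Let L : R := \prod_j (root_const (p j))%:R.

(** The exponents [1 - 1/p_j] of [root_ratio_le] add up to [1 + delta].  For the
    base [t] of these powers, [t] itself is kept as [k ^ c / n ^ k], ready for
    [sum_long_cycles_le], while [t `^ delta] is spent on decay in [n]: since
    [2c <= k], [t ^+ 2 <= (16 / n) ^+ k]. *)
Lemma prod_root_ratio_le (T : finType) (x : {perm T}) :
  \prod_(j < m) (#|roots (p j) x|%:R / #|torsion (p j) [set: T]|%:R)
   <= (4 * L * (16 / #|T|%:R) `^ (delta / 2)) ^+ #|moved x|
      * ((#|moved x| ^ #|long_cycles x|)%:R / (#|T| ^ #|moved x|)%:R) :> R.
Proof.
set s := #|moved x|; set c := #|long_cycles x|; set n := #|T|.
have sn : (s <= n)%N by apply: max_card.
have cs : (c.*2 <= s)%N by apply: card_long_cycles.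
set t : R := (c ^ c)%:R / (n ^_ s)%:R.
have N0 : (0 : R) < (n ^_ s)%:R by rewrite ltr0n ffact_gt0.
have t0 : 0 < t by rewrite divr_gt0 // ltr0n expn_gt0; case: (c).
(* Without moved points x is the identity, and T itself may be empty. *)
have [s0|s_gt0] := posnP s.
  have c0 : c = 0%N by move: cs; rewrite s0; lia.
  rewrite /t s0 c0 expr0 !expn0 divr1 mulr1.
  apply: prodr_ile1 => j _; rewrite divr_ge0 ?ler0n //=.
  rewrite ler_pdivrMr ?mul1r ?ltr0n ?card_torsion_gt0 // ler_nat.
  have x1 : x = 1%g.
    apply/permP => z; rewrite perm1; apply/eqP/negPn/negP => xz.
    by move: s0; apply/eqP; rewrite -lt0n; apply/card_gt0P; exists z; rewrite inE.
  by rewrite x1; apply/subset_leq_card/subsetP => y; rewrite !inE => ->;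
    rewrite andbT; have := Sym_setT y; rewrite inE.
have n0 : (0 : R) < n%:R by rewrite ltr0n (leq_trans s_gt0).
have ns0 : (0 : R) < n%:R ^+ s by rewrite exprn_gt0.
apply: le_trans (_ : (L ^+ s * t `^ (1 + delta)) <= _).
  apply: le_trans (_ : \prod_(j < m) ((root_const (p j))%:R ^+ s
      * t `^ (1 - (p j)%:R^-1)) <= _).
    apply: ler_prod => j _; rewrite divr_ge0 ?ler0n //=.
    by apply: root_ratio_le; apply: ltnW.
  rewrite big_split /= prodrXl prod_powR // /L.
  rewrite le_eqVlt; apply/predU1P; left; congr (_ * t `^ _).
  rewrite sumrB sumr_const card_ord /delta.
  by rewrite addrA addrCA subrr addr0.
rewrite powRD; last by rewrite (gt_eqF t0) implybT.
rewrite powRr1 ?(ltW t0) //.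
have t_le : t <= 4 ^+ s * (c%:R ^+ c / n%:R ^+ s).
  rewrite /t ler_pdivrMr // mulrA mulrAC ler_pdivlMr //.
  rewrite -!natrX -!natrM ler_nat [(4 ^ s * _)%N]mulnC -mulnA leq_mul2l.
  by rewrite expn_le_exp4_ffact ?orbT.
have t_le1 : t <= 4 ^+ s * ((s ^ c)%:R / (n ^ s)%:R).
  apply: le_trans t_le _; rewrite !natrX ler_pM2l ?exprn_gt0 //.
  rewrite ler_pM2r ?invr_gt0 // -!natrX ler_nat.
  by case: (c) cs => // k ks; rewrite leq_exp2r //; lia.
have t_le2 : t ^+ 2 <= (16 / n%:R) ^+ s.
  have c_le : c%:R ^+ c.*2 <= n%:R ^+ s :> R.
    rewrite -!natrX ler_nat; apply: (@leq_trans (n ^ c.*2)).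
      by case: (c) cs => // k ks; rewrite leq_exp2r //; lia.
    by rewrite leq_pexp2l //; lia.
  apply: le_trans (_ : (4 ^+ s * (c%:R ^+ c / n%:R ^+ s)) ^+ 2 <= _).
    by rewrite ler_sqr // nnegrE ltW // (lt_le_trans t0 t_le).
  have E16 : (4 ^+ s) ^+ 2 = 16 ^+ s :> R by rewrite exprAC -natrX.
  rewrite exprMn E16 expr_div_n -!exprM !muln2 expr_div_n.
  rewrite ler_pM2l ?exprn_gt0 // ler_pdivrMr ?exprn_gt0 //.
  by rewrite -[in leRHS]addnn [in leRHS]exprD mulKf ?gt_eqF.
have t_le3 : t `^ delta <= ((16 / n%:R) `^ (delta / 2)) ^+ s.
  have -> : t `^ delta = (t ^+ 2) `^ (delta / 2).
    by rewrite -powR_mulrn ?(ltW t0) // -powRrM mulrC divfK ?pnatr_eq0.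
  have -> : ((16 / n%:R) `^ (delta / 2)) ^+ s = ((16 / n%:R) ^+ s) `^ (delta / 2).
    rewrite -powR_mulrn ?powR_ge0 // -powRrM [delta / 2 * _]mulrC (powRrM _ s%:R) powR_mulrn //.
    by rewrite divr_ge0 ?ler0n.
  apply: ge0_ler_powR t_le2; rewrite ?nnegrE ?exprn_ge0 ?divr_ge0 ?ler0n //.
  exact: ltW.
apply: le_trans (_ : L ^+ s * ((4 ^+ s * ((s ^ c)%:R / (n ^ s)%:R))
   * ((16 / n%:R) `^ (delta / 2)) ^+ s) <= _).
  apply: ler_wpM2l; last by apply: ler_pM; rewrite ?powR_ge0 ?(ltW t0).
  by rewrite exprn_ge0 // prodr_ge0.
rewrite !exprMn [4 ^+ s * L ^+ s]mulrC -!mulrA.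
by rewrite [X in _ <= _ * (_ * X)]mulrC -!mulrA.
Qed.

(** The permutations are grouped by the number [s.+1] of moved points.  The
    constant 32 is the factor 4 of [prod_root_ratio_le] times the factor 8 of
    [sum_long_cycles_le]. *)
Lemma sum_root_ratio_le (T : finType) :
  \sum_(x : {perm T} | x != 1%g)
    \prod_(j < m) (#|roots (p j) x|%:R / #|torsion (p j) [set: T]|%:R)
  <= \sum_(s < #|T|) (32 * L * (16 / #|T|%:R) `^ (delta / 2)) ^+ s.+1 :> R.
Proof.
set q := (16 / _) `^ _; set n := #|T|; pose y := 4 * L * q.
have y0 : 0 <= y by rewrite !mulr_ge0 ?powR_ge0 ?prodr_ge0 // => j _.
have val_inord x : (inord #|@moved T x| : 'I_n.+1) = #|moved x| :> nat.
  by rewrite /= inordK // ltnS; apply: max_card.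
rewrite (partition_big (fun x : {perm T} => inord #|moved x| : 'I_n.+1)
  (fun s => s != ord0)) /=; last first.
  move=> x; apply: contraNN => /eqP/(congr1 val)/=; rewrite val_inord => x0.
  apply/eqP/permP => z; rewrite perm1; apply/eqP/negPn/negP => xz.
  by move/eqP: x0; rewrite -leqn0 leqNgt => /negP; apply; apply/card_gt0P;
    exists z; rewrite inE.
rewrite big_mkcond big_ord_recl /= ?eqxx add0r; apply: ler_sum => s _.
rewrite (_ : 32 * L * q = y * 8); last first.
  by rewrite /y -!mulrA [_ * 8]mulrC; lra.
rewrite exprMn; pose k := s.+1; rewrite -/k.
have k_gt0 : (0 : R) < (n ^ k)%:R.
  by rewrite ltr0n expn_gt0 (leq_trans _ (ltn_ord s)).
apply: le_trans (_ : \sum_(x : {perm T} | #|moved x| == k)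
    y ^+ k * ((k ^ #|long_cycles x|)%:R / (n ^ k)%:R) <= _).
  rewrite big_mkcond [leRHS]big_mkcond; apply: ler_sum => x _ /=.
  case: ifP => [/andP[_ /eqP xk]|_].
    have <- : #|moved x| = k by rewrite -val_inord xk.
    by rewrite eqxx; apply: prod_root_ratio_le.
  by case: ifP => // _; rewrite mulr_ge0 ?exprn_ge0 ?divr_ge0.
rewrite -big_distrr /= -big_distrl /= ler_wpM2l ?exprn_ge0 //.
rewrite ler_pdivrMr // -natr_sum -natrX -natrM ler_nat.
exact: sum_long_cycles_le.
Qed.

Lemma geometric_sum_le (z : R) n : 0 <= z -> z <= 2^-1 ->
  \sum_(s < n) z ^+ s.+1 <= 2 * z.
Proof.
move=> z0 z1; suff le : \sum_(s < n) z ^+ s.+1 <= 2 * z * (1 - z ^+ n).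
  apply: le_trans le _; rewrite ler_piMr ?mulr_ge0 //.
  by rewrite gerBl exprn_ge0.
elim: n => [|n IH]; first by rewrite big_ord0 expr0 subrr mulr0.
rewrite big_ord_recr /= !exprS; apply: le_trans (lerD IH (lexx _)) _.
have : 0 <= z ^+ n by rewrite exprn_ge0.
move: (z ^+ n) => u u0; have : 0 <= z * u * (1 - 2 * z).
  by rewrite !mulr_ge0 // subr_ge0 mulrC -ler_pdivlMr // mul1r.
by lra.
Qed.

Local Notation bound n := (32 * L * (16 / n%:R) `^ (delta / 2)).

Lemma cvg_bound : bound n @[n --> \oo] --> (0 : R).
Proof.
rewrite -[0](mulr0 (32 * L)); apply: cvgMr.
apply/cvgr0Pnorm_lt => e e0.
have d0 : 0 < delta / 2 by rewrite divr_gt0.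
near=> n; have n0 : (0 : R) < n%:R by near: n; exact: nbhs_infty_gtr.
rewrite ger0_norm ?powR_ge0 //.
have -> : e = (e `^ (delta / 2)^-1) `^ (delta / 2).
  by rewrite -powRrM mulVf ?gt_eqF // powRr1 // ltW.
apply: gt0_ltr_powR; rewrite ?nnegrE ?powR_ge0 ?divr_ge0 //.
rewrite ltr_pdivrMr // mulrC -ltr_pdivrMr ?powR_gt0 //.
by near: n; exact: nbhs_infty_gtr.
Unshelve. all: by end_near. Qed.

(** The quotient is [1 / (1 + E n)], where [0 <= E n <= 2 * bound n] for large
    [n]. *)
Lemma cvg_torsion_roots :
  (fun n => (\prod_(j < m) #|torsion (p j) [set: 'I_n]|)%:R
    / (\sum_(x : 'S_n) \prod_(j < m) #|roots (p j) x|)%:R : R) @ \oo --> (1 : R).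
Proof.
pose E n : R := \sum_(x : 'S_n | x != 1%g)
    \prod_(j < m) (#|roots (p j) x|%:R / #|torsion (p j) [set: 'I_n]|%:R).
have E0 n : 0 <= E n by apply: sumr_ge0 => x _; apply: prodr_ge0 => j _; rewrite divr_ge0.
have fE n : (\prod_(j < m) #|torsion (p j) [set: 'I_n]|)%:R
    / (\sum_(x : 'S_n) \prod_(j < m) #|roots (p j) x|)%:R = (1 + E n)^-1 :> R.
  set P := (\prod_(j < m) _)%N.
  have P0 : P%:R != 0 :> R.
    by rewrite pnatr_eq0 -lt0n prodn_gt0 // => j; apply: card_torsion_gt0.
  rewrite -[LHS]invf_div; congr (_^-1); rewrite natr_sum (bigD1 1%g) //= mulrDl.
  congr (_ + _).
    rewrite (_ : \prod_(j < m) _ = P)%N ?divff //; apply: eq_bigr => j _.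
    apply: eq_card => x; rewrite !inE /=.
    by have := Sym_setT x; rewrite inE => ->.
  rewrite big_distrl /=; apply: eq_bigr => x _.
  by rewrite !natr_prod -prodf_div.
have E_le n : bound n <= 2^-1 -> E n <= 2 * bound n.
  move=> bn; have := @sum_root_ratio_le 'I_n; rewrite card_ord => /le_trans; apply.
  by apply: geometric_sum_le => //; rewrite !mulr_ge0 ?powR_ge0 ?prodr_ge0 // => j _.
under [X in X @ _]boolp.eq_fun do rewrite fE.
apply: (@squeeze_cvgr _ _ _ _ (fun n => 1 - 2 * bound n) (fun=> 1)).
- near=> n; have bn : bound n <= 2^-1.
    near: n; apply: (cvgr_le _ cvg_bound); first by rewrite invr_gt0.
  have := E_le n bn; have := E0 n; move: (E n) (bound n) => e b e0 eb.
  have e1 : 0 < 1 + e by lra.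
  rewrite invf_le1 // lerDl e0 andbT -[_^-1]mul1r ler_pdivlMr //.
  by nra.
- rewrite -[X in _ --> X]subr0 -[X in _ - X](mulr0 2).
  by apply: cvgB; [exact: cvg_cst | apply: cvgMr; exact: cvg_bound].
- exact: cvg_cst.
Unshelve. all: by end_near. Qed.

End RealEstimates.

(** * Homomorphisms as tuples of permutations *)

Section CountHom.
Local Open Scope group_scope.

Lemma card_set_bij (T : choiceType) (U : finType) (A : classical_sets.set T)
    (B : {set U}) (f : T -> U) :
    finite_set A -> (forall x y, A x -> A y -> f x = f y -> x = y) ->
    (forall x, A x -> f x \in B) -> (forall u, u \in B -> exists2 x, A x & f x = u) ->
  card_set A = #|B|.
Proof.
move=> finA fI fB fS; rewrite /card_set.
have memA x : (x \in fset_set A) <-> A x.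
  by rewrite in_fset_set // in_setE.
rewrite -(size_map f) -(card_uniqP _); last first.
  rewrite map_inj_in_uniq ?fset_uniq // => x y /memA Ax /memA Ay; exact: fI.
apply: eq_card => u; apply/mapP/idP => [[x /memA Ax ->]|/fS[x Ax <-]].
  exact: fB.
by exists x => //; apply/memA.
Qed.

Section Gamma.
Variables (m : nat) (p : 'I_m -> nat) (H : finGroupType).
Implicit Types t : {ffun 'I_m -> H}.

Definition gens_image (f : Gamma p -> H) : {ffun 'I_m -> H} :=
  [ffun j => f (Gamma_gen p j)].

Lemma group_HomX (G K : groupType) (f : G -> K) x k : group_Hom G K f ->
  f (x ^+ k) = f x ^+ k.
Proof.
move=> fM; have f1 : f 1 = 1 by apply: (mulgI (f 1)); rewrite -fM !mulg1.
by elim: k => [|k IHk]; rewrite ?expg0 // !expgS fM IHk.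
Qed.

Lemma gens_image_inj f g : group_Hom (Gamma p) H f -> group_Hom (Gamma p) H g ->
  gens_image f = gens_image g -> f = g.
Proof.
move=> fM gM /ffunP fg; apply: pres_morph_ext => // j.
by have := fg j; rewrite !ffunE.
Qed.

Lemma Gamma_lift t : (forall i j, t i ^+ p i = t j ^+ p j) ->
  exists2 f, group_Hom (Gamma p) H f & gens_image f = t.
Proof.
move=> tp; have ev j : word_eval t (nseq (p j) (j, false)) = t j ^+ p j.
  rewrite /word_eval; elim: (p j) => [|k IHk]; first by rewrite big_nil.
  by rewrite /= big_cons IHk expgS.
have [|f fE] := @pres_lift _ (Gamma_rel p) H t.
  by move=> _ _ [i [j [-> ->]]]; rewrite !ev.
exists f; first exact: gmulfM.
by apply/ffunP => j; rewrite ffunE fE.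
Qed.

(** The tuples of generator images are sorted by their common power [x]; for
    [m = 0] there would be no such power. *)
Lemma card_group_Hom_Gamma : (0 < m)%N ->
  card_set (group_Hom (Gamma p) H)
    = (\sum_(x : H) \prod_(j < m) #|[set y : H | y ^+ p j == x]|)%N.
Proof.
move=> m0; pose j0 := Ordinal m0.
pose B := [set t : {ffun 'I_m -> H} | [forall j, t j ^+ p j == t j0 ^+ p j0]].
have BP t : reflect (forall i j, t i ^+ p i = t j ^+ p j) (t \in B).
  rewrite inE; apply: (iffP forallP) => tp i; last by rewrite (tp i j0).
  by move=> j; rewrite (eqP (tp i)) (eqP (tp j)).
rewrite (@card_set_bij _ _ _ B gens_image).
- rewrite -sum1_card (partition_big (fun t => t j0 ^+ p j0) predT) //=.
  apply: eq_bigr => x _; rewrite sum1dep_card.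
  transitivity #|family (fun j => mem [set y : H | y ^+ p j == x])|.
    apply: eq_card => t; rewrite !inE; apply/andP/familyP => [[/forallP tp tx] j|tp].
      by rewrite !inE (eqP (tp j)).
    have {}tp j : t j ^+ p j = x by have := tp j; rewrite !inE => /eqP.
    by split; rewrite ?tp //; apply/forallP => j; rewrite !tp.
  by rewrite card_family foldrE big_map big_enum.
- exact: finite_group_Hom_Gamma.
- exact: gens_image_inj.
- by move=> f fM; apply/BP => i j; rewrite !ffunE -!group_HomX // (Gamma_relP p i j).
- by move=> t /BP/Gamma_lift.
Qed.

Lemma cyclic_lift k (c : 'Z_k) (y : H) : (1 < k)%N ->
    generator [set: 'Z_k] c -> y ^+ k = 1 ->
  exists f : {multiplicative ('Z_k : groupType) -> H}, f c = y.
Proof.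
move=> k1 cG yk; have oc : #[c] = k.
  by rewrite orderE -(eqP cG) cardsT card_ord Zp_cast.
have dv : #[y] %| #[c] by rewrite oc order_dvdn yk.
have cT a : a \in <[c]> by rewrite -(eqP cG) inE.
have fM : {morph (eltm dv : 'Z_k -> H) : a b / a * b}.
  by move=> a b; rewrite morphM.
pose fm := isMultiplicative.Build ('Z_k : groupType) H (eltm dv) fM.
exists (HB.pack_for {multiplicative ('Z_k : groupType) -> H} (eltm dv : 'Z_k -> H) fm).
exact: eltm_id.
Qed.

(** A tuple with [t j ^+ p j = 1] extends to each cyclic factor separately, the
    generator [c] of the factor being sent to [t j], hence to the free product. *)
Lemma card_group_Hom_factoring
    (Phi : {multiplicative Gamma p -> cyclic_free_prod p}) :
    (forall j, (1 < p j)%N) -> sends_gens_to_generators Phi ->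
  card_set (group_Hom_factoring H Phi)
    = (\prod_(j < m) #|[set y : H | y ^+ p j == 1%g]|)%N.
Proof.
move=> p_gt1 PhiP.
rewrite (@card_set_bij _ _ _
  [set t : {ffun 'I_m -> H} | [forall j, t j ^+ p j == 1]] gens_image).
- transitivity #|family (fun j => mem [set y : H | y ^+ p j == 1])|.
    apply: eq_card => t; rewrite inE.
    by apply/forallP/familyP => tp j; have := tp j; rewrite !inE.
  by rewrite card_family foldrE big_map big_enum.
- apply: sub_finite_set (finite_group_Hom_Gamma p H).
  by move=> f [].
- by move=> f g [fM _] [gM _]; apply: gens_image_inj.
- move=> _ [_ [g gM ->]]; rewrite inE; apply/forallP => j.
  have [c cG Phic] := PhiP j; rewrite ffunE /= Phic -group_HomX //.
  have oc : #[c] = p j by rewrite orderE -(eqP cG) cardsT card_ord Zp_cast.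
  rewrite -free_prod_injX (_ : _ ^+ p j = 1); last first.
    by rewrite -[X in _ ^+ X]oc; apply: expg_order.
  rewrite free_prod_inj1; apply/eqP.
  by have := group_HomX 1 0 gM; rewrite !expg0.
move=> t; rewrite inE => /forallP tp.
have lift_ex j : exists f : {multiplicative cyclic_factor p j -> H},
    exists2 c, Phi (Gamma_gen p j) = free_prod_inj c & f c = t j.
  have [c cG Phic] := PhiP j.
  have [f fc] := cyclic_lift (p_gt1 j) cG (eqP (tp j)).
  by exists f, c.
have [g gE] := free_prod_lift (fun j => projT1 (cid (lift_ex j))).
have gPhi j : g (Phi (Gamma_gen p j)) = t j.
  have [c Phic fc] := projT2 (cid (lift_ex j)).
  exact: etrans (congr1 g Phic) (etrans (gE j c) fc).
exists (g \o Phi); last by apply/ffunP => j; rewrite ffunE /= gPhi.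
split; first by move=> x y /=; rewrite !gmulfM.
by exists g => //; apply: gmulfM.
Qed.

End Gamma.
End CountHom.

Local Open Scope classical_set_scope.
Local Open Scope ring_scope.

Theorem theorem1p2 (R : realType) (m : nat) (p : 'I_m -> nat)
    (p_gt1 : forall j, (1 < p j)%N)
    (p_hyp : \sum_(j < m) (p j)%:R^-1 < m%:R - 1 :> R)
    (Phi : {multiplicative Gamma p -> cyclic_free_prod p})
    (PhiP : sends_gens_to_generators Phi) :
  (fun n : nat =>
     (card_set (group_Hom_factoring 'S_n Phi))%:R
       / (card_set (group_Hom (Gamma p) 'S_n))%:R : R) @ \oo --> (1 : R).
Proof.
have m_gt0 : (0 < m)%N.
  case: (m) p p_hyp {p_gt1 Phi PhiP} => // p'.
  by rewrite big_ord0 sub0r oppr_gt0 ltr10.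
have delta_gt0 : 0 < m%:R - 1 - \sum_(j < m) (p j)%:R^-1 :> R by rewrite subr_gt0.
apply: cvg_trans (cvg_torsion_roots p_gt1 delta_gt0).
apply: near_eq_cvg; near=> n.
rewrite card_group_Hom_Gamma // (card_group_Hom_factoring _ p_gt1) //.
congr (_%:R / _); apply: eq_bigr => j _; apply: eq_card => x.
by rewrite !inE; have := Sym_setT x; rewrite inE => ->.
Unshelve. all: by end_near. Qed.
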